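(* Let $b_n$ be the number of paths in $\mathcal{M}_2$ of length $n$ ending on the $x$-axis. Then $$\sum_{n\ge0}b_nz^n=\frac{1}{zr},\qquad\text{where } r=\frac{z+1+\sqrt{1-2z-3z^{2}}}{2z(z+1)}.$$
   Context: Let $U=(1,1)$, $H=(1,0)$ and $D_k=(1,-k)$ for $k\ge 1$ (down steps). $\mathcal{M}_2$ is the set of lattice paths in $\mathbb{N}^2$ (with $\mathbb{N}=\{0,1,2,\dots\}$, so paths never go below the $x$-axis) starting at the origin, made of steps $U$, $H$ and $D_k$ ($k\ge1$), in which every down step and every horizontal step, except possibly when it is the last step of the path, is immediately followed by an up step $U$. The empty path belongs to $\mathcal{M}_2$. The length of a path is its number of steps. The square root is the power series with constant term $1$, and $r$ is a Laurent series in $z$. *)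

(* Defs.v *)
(* MathComp, with the classical layer of MathComp-Analysis *)
From HB Require Import structures.
From mathcomp Require Import all_boot all_order all_algebra.
From mathcomp Require Import fraction finmap.
From mathcomp Require Import boolp classical_sets functions cardinality.

Set Implicit Arguments.
Unset Strict Implicit.
Unset Printing Implicit Defensive.
Import Order.TTheory GRing.Theory Num.Theory.
Local Open Scope ring_scope.

Record fps (K : Type) := Fps { fcoef : nat -> K }.

Section FpsRing.
Variable K : fieldType.
Implicit Types s t u : fps K.

HB.instance Definition _ := gen_eqMixin (fps K).
HB.instance Definition _ := gen_choiceMixin (fps K).

Lemma fpsP s t : fcoef s =1 fcoef t <-> s = t.
Proof. by split=> [|-> //]; case: s t => [s] [t] /funext /= ->. Qed.

Definition fps_zero : fps K := Fps (fun=> 0).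
Definition fps_one : fps K := Fps (fun n => (n == 0)%:R).
Definition fps_opp s : fps K := Fps (fun n => - fcoef s n).
Definition fps_add s t : fps K := Fps (fun n => fcoef s n + fcoef t n).
Definition fps_mul s t : fps K :=
  Fps (fun n => \sum_(i < n.+1) fcoef s i * fcoef t (n - i)).

Lemma fps_addA : associative fps_add.
Proof. by move=> s t u; apply/fpsP => n /=; rewrite addrA. Qed.
Lemma fps_addC : commutative fps_add.
Proof. by move=> s t; apply/fpsP => n /=; rewrite addrC. Qed.
Lemma fps_add0 : left_id fps_zero fps_add.
Proof. by move=> s; apply/fpsP => n /=; rewrite add0r. Qed.
Lemma fps_addN : left_inverse fps_zero fps_opp fps_add.
Proof. by move=> s; apply/fpsP => n /=; rewrite addNr. Qed.

HB.instance Definition _ :=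
  GRing.isZmodule.Build (fps K) fps_addA fps_addC fps_add0 fps_addN.

Definition fps_trunc m s : {poly K} := \poly_(i < m) fcoef s i.

Lemma coef_fps_trunc m s i : (i < m)%N -> (fps_trunc m s)`_i = fcoef s i.
Proof. by move=> lt_im; rewrite coef_poly lt_im. Qed.

Lemma fcoef_mul_trunc m s t n : (n < m)%N ->
  fcoef (fps_mul s t) n = (fps_trunc m s * fps_trunc m t)`_n.
Proof.
move=> lt_nm; rewrite coefM /=; apply: eq_bigr => i _.
by rewrite !coef_fps_trunc// (leq_ltn_trans _ lt_nm) ?leq_subr// -ltnS.
Qed.

Lemma fps_mulC : commutative fps_mul.
Proof.
move=> s t; apply/fpsP => n.
by rewrite !(@fcoef_mul_trunc n.+1)// mulrC.
Qed.

Lemma fps_mulA : associative fps_mul.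
Proof.
move=> s t u; apply/fpsP => n.
transitivity (fps_trunc n.+1 s * (fps_trunc n.+1 t * fps_trunc n.+1 u))`_n.
  rewrite coefM [LHS]/=; apply: eq_bigr => i _.
  by rewrite coef_fps_trunc// -fcoef_mul_trunc// ltnS leq_subr.
rewrite mulrA coefM [RHS]/=; apply: eq_bigr => i _.
by rewrite -fcoef_mul_trunc// coef_fps_trunc// ltnS leq_subr.
Qed.

Lemma fps_mul1 : left_id fps_one fps_mul.
Proof.
move=> s; apply/fpsP => n /=; rewrite big_ord_recl /= mul1r subn0.
by rewrite big1 ?addr0// => i _; rewrite mul0r.
Qed.

Lemma fps_mulDl : left_distributive fps_mul fps_add.
Proof.
move=> s t u; apply/fpsP => n /=; rewrite -big_split /=.
by apply: eq_bigr => i _; rewrite mulrDl.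
Qed.

Lemma fps_one_neq0 : fps_one != fps_zero.
Proof.
by apply/eqP => /fpsP /(_ 0) /eqP; rewrite /= oner_eq0.
Qed.

HB.instance Definition _ := GRing.Zmodule_isComNzRing.Build (fps K)
  fps_mulA fps_mulC fps_mul1 fps_mulDl fps_one_neq0.

Definition fps_unit : {pred fps K} := [pred s | `[< exists t, t * s = 1 >]].
Definition fps_inv s : fps K :=
  if pselect (exists t, t * s = 1) is left ex then projT1 (cid ex) else s.

Lemma fps_mulVs : {in fps_unit, left_inverse 1 fps_inv *%R}.
Proof.
move=> s /asboolP ex; rewrite /fps_inv; case: pselect => // {}ex.
by case: cid.
Qed.

Lemma fps_unitPl s t : t * s = 1 -> fps_unit s.
Proof. by move=> ts; apply/asboolP; exists t. Qed.

Lemma fps_inv_out : {in [predC fps_unit], fps_inv =1 id}.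
Proof.
by move=> s /asboolP nex; rewrite /fps_inv; case: pselect.
Qed.

HB.instance Definition _ := GRing.ComNzRing_hasMulInverse.Build (fps K)
  fps_mulVs fps_unitPl fps_inv_out.

Lemma fps_neq0_valuation s : s != 0 ->
  exists2 m, fcoef s m != 0 & forall i, (i < m)%N -> fcoef s i = 0.
Proof.
move=> s0; have ex : exists m, fcoef s m != 0.
  apply: contrapT => /forallNP s_eq0; move/eqP: s0; apply.
  by apply/fpsP => n; apply/eqP/negPn/negP; exact: s_eq0.
exists (ex_minn ex); case: ex_minnP => // m _ min_m i lt_im.
by apply/eqP; apply: contraTT lt_im => /min_m; rewrite -leqNgt.
Qed.

Lemma fps_idomain s t : s * t = 0 -> (s == 0) || (t == 0).
Proof.
move=> st0; apply: contrapT => /negP; rewrite negb_or => /andP[].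
move=> /fps_neq0_valuation[m sm s0] /fps_neq0_valuation[p tp t0].
have /eqP : fcoef (s * t) (m + p) = 0 by rewrite st0.
have lt_m : (m < (m + p).+1)%N by rewrite ltnS leq_addr.
rewrite [fcoef _ _]/= (bigD1 (Ordinal lt_m))//= big1 ?addr0; last first.
  move=> i ne_im; have [lt_im|] := ltnP i m; first by rewrite s0 ?mul0r.
  rewrite leq_eqVlt => /orP[/eqP eq_mi|lt_mi].
    by case/eqP: ne_im; apply/val_inj.
  by rewrite t0 ?mulr0// -(ltn_add2r i) subnK ?[(p + i)%N]addnC ?ltn_add2r ?(leq_ord i).
by rewrite addKn mulf_eq0 (negPf sm) (negPf tp).
Qed.

HB.instance Definition _ :=
  GRing.ComUnitRing_isIntegral.Build (fps K) fps_idomain.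

Definition fpsX : fps K := Fps (fun n => (n == 1)%:R).

(* The power series with constant term 1 whose square is f; the default value
   0 is irrelevant as soon as f has constant term 1 and 2 is invertible, see
   fps_sqrtP and fps_sqrt_uniq *)
Definition fps_sqrt (f : fps K) : fps K :=
  xget 0 [set s : fps K | s ^+ 2 = f /\ fcoef s 0 = 1]%classic.

Lemma fps_sqrt_ex (f : fps K) : (2 : K) != 0 -> fcoef f 0 = 1 ->
  exists s : fps K, s ^+ 2 = f /\ fcoef s 0 = 1.
Proof.
move=> two_neq0 f0.
pose next (l : seq K) := let n := size l in
  (fcoef f n - \sum_(1 <= i < n) l`_i * l`_(n - i)) / 2.
pose l n := iter n (fun l => rcons l (next l)) [:: 1].
have size_l n : size (l n) = n.+1.
  by elim: n => //= n IH; rewrite size_rcons IH.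
have nth_l n m : (m <= n)%N -> (l n)`_m = (l m)`_m.
  elim: n => [|n IH]; first by case: m.
  rewrite leq_eqVlt => /orP[/eqP-> //|le_mn].
  by rewrite [l n.+1]/= nth_rcons size_l le_mn IH.
pose c n := (l n)`_n.
have c0 : c 0%N = 1 by [].
have cS n : c n.+1 = (fcoef f n.+1 - \sum_(i < n) c i.+1 * c (n - i)%N) / 2.
  rewrite /c [l n.+1]/= nth_rcons size_l ltnn eqxx /next size_l.
  rewrite big_add1 big_mkord; congr ((_ - _) / _).
  by apply: eq_bigr => i _; rewrite subSS !(@nth_l n) ?leq_subr.
exists (Fps c); split=> //; apply/fpsP => -[|n].
  by rewrite expr2 /= big_ord1 c0 mulr1 f0.
rewrite expr2 [LHS]/= big_ord_recl big_ord_recr /= subn0 subnn c0 mul1r mulr1.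
rewrite addrCA -mulr2n -[X in _ + X]mulr_natr cS mulfVK// addrC.
exact: subrK.
Qed.

Lemma fps_sqrtP (f : fps K) : (2 : K) != 0 -> fcoef f 0 = 1 ->
  fps_sqrt f ^+ 2 = f /\ fcoef (fps_sqrt f) 0 = 1.
Proof.
move=> two_neq0 f0; rewrite /fps_sqrt; case: xgetP => [s _ //|nex].
by have [s /nex] := fps_sqrt_ex two_neq0 f0.
Qed.

Lemma fps_sqrt_uniq (f s : fps K) : (2 : K) != 0 ->
  s ^+ 2 = f -> fcoef s 0 = 1 -> fps_sqrt f = s.
Proof.
move=> two_neq0 sf s0; have f0 : fcoef f 0 = 1.
  by rewrite -sf expr2 /= big_ord1 s0 mulr1.
have [rf r0] := fps_sqrtP two_neq0 f0.
have /eqP : s ^+ 2 = fps_sqrt f ^+ 2 by rewrite sf rf.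
rewrite eqf_sqr => /orP[/eqP-> //|/eqP s_opp].
have : fcoef s 0 = - fcoef (fps_sqrt f) 0 by rewrite s_opp.
by rewrite s0 r0 => /eqP; rewrite -addr_eq0 (negPf two_neq0).
Qed.

End FpsRing.

(* A quotient of two power series is a power of X times a power series, so the
   fraction field of K[[X]] is the field of Laurent series. *)
Notation laurent K := {fraction (fps K)}.

Definition fps_laurent (K : fieldType) (s : fps K) : laurent K :=
  FracField.tofrac s.

(* DownS k encodes the step D_(k+1) = (1, -(k+1)). *)
Inductive step := Up | Horiz | DownS of nat.

Definition step_encode (s : step) : option (option nat) :=
  match s with Up => None | Horiz => Some None | DownS k => Some (Some k) end.
Definition step_decode (o : option (option nat)) : step :=
  match o with None => Up | Some None => Horiz | Some (Some k) => DownS k end.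
Lemma step_encodeK : cancel step_encode step_decode.
Proof. by case. Qed.

HB.instance Definition _ := Countable.copy step (can_type step_encodeK).

Definition dy (s : step) : int :=
  match s with Up => 1 | Horiz => 0 | DownS k => - (k.+1)%:Z end.

(* The ordinate of the endpoint of a path; all steps have abscissa 1, so the
   abscissa is the number of steps. *)
Definition height (p : seq step) : int := \sum_(s <- p) dy s.

Definition inM2 (p : seq step) : Prop :=
  (forall i, 0 <= height (take i p))
  /\ sorted [rel s t : step | (s != Up) ==> (t == Up)] p.

Definition excursions (n : nat) : set (seq step) :=
  [set p | [/\ inM2 p, size p = n & height p = 0]]%classic.

Definition b (n : nat) : nat := #|` fset_set (excursions n)|.

Lemma height_le_size (p : seq step) : height p <= (size p)%:Z.
Proof.
rewrite /height; elim: p => [|s p IH]; first by rewrite big_nil.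
rewrite big_cons /= -add1n PoszD lerD//.
by case: s => // k; apply: (@le_trans _ _ 0).
Qed.

Lemma excursions_finite (n : nat) : finite_set (excursions n).
Proof.
pose T := seq_sub (Up :: Horiz :: [seq DownS k | k <- iota 0 n]).
pose f (t : n.-tuple T) : seq step := map val t.
apply: (@sub_finite_set _ _ (f @` setT)%classic); last by apply: finite_image; exact: finite_finset.
move=> p [[pos _] sz _].
have all_p s : s \in p -> s \in Up :: Horiz :: [seq DownS k | k <- iota 0 n].
  move=> /(nthP Up)[i lt_ip <-].
  have := pos i.+1; rewrite (take_nth Up)// /height -cats1 big_cat big_seq1 /=.
  case: (nth Up p i) => [||k] h //.
  rewrite !inE /= map_f// mem_iota /= add0n -sz -ltz_nat.
  have := height_le_size (take i p); rewrite size_takel ?(ltnW lt_ip)// => h'.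
  move: h; rewrite subr_ge0 => /le_trans/(_ h').
  by rewrite lez_nat ltz_nat => /leq_trans; apply; exact: ltnW.
have [q qp] : exists q : seq T, map val q = p.
  elim: p {pos sz} all_p => [|s p IH] all_p; first by exists [::].
  have [|q <-] := IH; first by move=> x xp; apply: all_p; rewrite inE xp orbT.
  by exists (SeqSub (all_p s (mem_head _ _)) :: q).
have szq : size q == n by rewrite -sz -qp size_map.
by exists (Tuple szq).
Qed.

(* Main.v *)
Require Import Defs.
From mathcomp Require Import all_boot all_order all_algebra fraction.
From mathcomp Require Import finmap boolp classical_sets cardinality zify ring.
Import Order.TTheory GRing.Theory Num.Theory.
Local Open Scope ring_scope.

(** Classify the ways of completing a path by the current height h and by
    whether the last step was an up step. After an up step (or at the start)
    the next height is anything in 0, ..., h+1; after another step it has to be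
    h+1. Writing F_h for the generating function, by number of remaining steps,
    of the completions that end on the axis and may begin with any step, this
    gives

      F_h = [h = 0] + z (F_(h+1) + sum_(j <= h) ([j = 0] + z F_(j+1))),

    since after a horizontal or down step to height j the completion is either
    empty (if j = 0) or an up step followed by a completion counted by
    F_(j+1). Taking differences in h turns this into a linear recurrence, valid
    for h >= 2, with characteristic equation

      z (1 + z) x^2 - (1 + z) x + 1 = 0.

    Its two roots are r, which has a pole at z = 0, and the power series
    rho = 2 / (z + 1 + sqrt (1 - 2z - 3z^2)), and only powers of rho can occur
    in the power series F_h. Fitting the boundary equations at h = 0 and h = 1
    gives F_h = [h = 0] + ((1 + z) rho - 1) rho^h. In particular
    F_0 = (1 + z) rho, and this is 1 / (z r) because the product of the two
    roots is 1 / (z (1 + z)).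

    The formal proof guesses this closed form and verifies it: the recurrence
    determines the coefficients of all the F_h by induction on the number of
    remaining steps (size_completions), and the closed form satisfies it
    (free_gf_rec). The combinatorial side is an explicit duplicate-free
    enumeration of the completions (completionsP, uniq_completions). *)

(** * Power series *)

Section FpsInverse.
Variable K : fieldType.
Implicit Types s t : fps K.

Lemma fcoefD s t n : fcoef (s + t) n = fcoef s n + fcoef t n.
Proof. by []. Qed.

Lemma fcoef_sum (I : Type) (r : seq I) (F : I -> fps K) n :
  fcoef (\sum_(i <- r) F i) n = \sum_(i <- r) fcoef (F i) n.
Proof. exact: (big_morph (fun s => fcoef s n)). Qed.

Lemma fcoef_nat0 (m : nat) : fcoef (m%:R : fps K) 0 = m%:R.
Proof. by elim: m => // m IH; rewrite -!natr1 fcoefD IH. Qed.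

Lemma fcoef_natS (m n : nat) : fcoef (m%:R : fps K) n.+1 = 0.
Proof. by elim: m => // m IH; rewrite -natr1 fcoefD IH addr0. Qed.

Lemma fcoef_Xmul0 s : fcoef (fpsX K * s) 0 = 0.
Proof. by rewrite /= big_ord1 mul0r. Qed.

Lemma fcoef_XmulS s n : fcoef (fpsX K * s) n.+1 = fcoef s n.
Proof.
rewrite /= 2!big_ord_recl /= mul0r add0r mul1r subSS subn0.
by rewrite big1 ?addr0// => i _; rewrite mul0r.
Qed.

(** Comparing coefficients in t * s = 1 determines those of t one at a time;
    the lists l n are the prefixes of t built in this way. *)
Lemma fps_inverse s : fcoef s 0 != 0 -> exists t, t * s = 1.
Proof.
move=> s0.
pose next (l : seq K) := let n := size l in
  - (\sum_(i < n) l`_i * fcoef s (n - i)) / fcoef s 0.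
pose l n := iter n (fun l => rcons l (next l)) [:: (fcoef s 0)^-1].
have size_l n : size (l n) = n.+1.
  by elim: n => //= n IH; rewrite size_rcons IH.
have nth_l n m : (m <= n)%N -> (l n)`_m = (l m)`_m.
  elim: n => [|n IH]; first by case: m.
  rewrite leq_eqVlt => /orP[/eqP-> //|le_mn].
  by rewrite [l n.+1]/= nth_rcons size_l le_mn IH.
exists (Fps (fun n => (l n)`_n)); apply/fpsP => -[|n].
  by rewrite /= big_ord1 /= mulVf.
rewrite [LHS]/= big_ord_recr /= subnn nth_rcons size_l ltnn eqxx.
rewrite /next size_l divfK// -[RHS](subrr (\sum_(i < n.+1)
  (l n)`_i * fcoef s (n.+1 - i))); congr (_ - _).
by apply: eq_bigr => i _; rewrite (nth_l n i)// -ltnS.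
Qed.

End FpsInverse.

(** * Enumeration of the path completions *)

(** Down steps have arbitrary size, so a step from height h is determined by
    its target j <= h + 1, which may be prescribed freely. *)
Definition step_to (h j : nat) : step :=
  if j == h.+1 then Up else if j == h then Horiz else DownS (h - j).-1.

Lemma step_to_up h j : (step_to h j == Up) = (j == h.+1).
Proof. by rewrite /step_to; case: ifP => // _; case: ifP. Qed.

Lemma dy_step_to h j : (j <= h.+1)%N -> h%:Z + dy (step_to h j) = j%:Z.
Proof.
by rewrite /step_to => le_j; case: eqP => [->|?] /=; last case: eqP => [->|?] /=; lia.
Qed.

Lemma step_toE h j s : h%:Z + dy s = j%:Z -> s = step_to h j.
Proof.
rewrite /step_to; case: s => [||k] /= hj.
- have -> : j = h.+1 by lia.
  by rewrite eqxx.
- have -> : j = h by lia.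
  by rewrite eqxx ltn_eqF.
- rewrite !ifF; [congr DownS| |]; lia.
Qed.

(** The heights attainable in one step from height h when the previous step
    is x. *)
Definition reach (x : step) (h : nat) : seq nat :=
  if x == Up then iota 0 h.+2 else [:: h.+1].

Lemma mem_reach x h j : (j \in reach x h) =
  (j <= h.+1)%N && ((x != Up) ==> (step_to h j == Up)).
Proof.
rewrite step_to_up /reach; case: (x == Up); first by rewrite mem_iota andbT.
by rewrite inE; case: eqP => [->|]; rewrite /= ?leqnn ?andbF.
Qed.

(** The paths with n steps from height h to the axis that may follow a
    step x. The start of a path imposes the same condition as an up step, namely
    none. *)
Fixpoint completions (x : step) (n h : nat) : seq (seq step) :=
  if n is m.+1 then
    [seq step_to h j :: p | j <- reach x h, p <- completions (step_to h j) m j]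
  else nseq (h == 0)%N [::].

(** Requiring the height to be nonnegative after the first step is what makes
    the target of that step a natural number, hence an index of the
    enumeration. *)
Lemma completionsP x n h p : p \in completions x n h <->
  [/\ size p = n, path [rel s t : step | (s != Up) ==> (t == Up)] x p,
      forall i, 0 <= h%:Z + height (take i p) & h%:Z + height p = 0].
Proof.
have height0 : height [::] = 0 by rewrite /height big_nil.
have height_cons s q : height (s :: q) = dy s + height q.
  by rewrite /height big_cons.
elim: n x h p => [|n IH] x h p.
  rewrite mem_nseq lt0b; split=> [/andP[/eqP h0 /eqP->]|[/size0nil-> _ _]].
    by split=> //; rewrite h0 ?height0// => i; rewrite height0.
  by rewrite height0 addr0 eqxx andbT => -[->].
split=> [/allpairsPdep[j [q [jP qP ->]]]|].
  move: jP; rewrite mem_reach => /andP[le_j xj].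
  have [<- pq pos hq] := (IH _ _ _).1 qP.
  split=> //; first by rewrite /= xj.
    case=> [|i]; first by rewrite take0 height0 addr0.
    by rewrite take_cons height_cons addrA dy_step_to.
  by rewrite height_cons addrA dy_step_to.
case: p => [[]//|s q] [[sz] /= /andP[xs pq] pos hq].
have [j hj] : exists j : nat, h%:Z + dy s = j%:Z.
  have := pos 1%N; rewrite /= take0 height_cons height0 addr0.
  by case: (h%:Z + dy s) => // j _; exists j.
have sE := step_toE _ _ _ hj.
apply/allpairsPdep; exists j, q; split; last by rewrite -sE.
  rewrite mem_reach -sE xs andbT.
  by case: s {xs pq pos hq sE} hj => [||k] /=; lia.
apply/IH; split=> //; first by rewrite -sE.
  by move=> i; have := pos i.+1; rewrite /= height_cons addrA hj.
by rewrite -hj -addrA -height_cons.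
Qed.

(** The target height, hence the branch of the enumeration, can be read off
    the first step. *)
Lemma uniq_completions x n h : uniq (completions x n h).
Proof.
elim: n x h => [|n IH] x h; first by rewrite /=; case: eqP.
apply: allpairs_uniq_dep => //.
- by rewrite /reach; case: ifP => // _; exact: iota_uniq.
- move=> [j p] [k q] /allpairsPdep[j' [p' [jP _ [-> _]]]].
  move=> /allpairsPdep[k' [q' [kP _ [-> _]]]] /= [jk ->].
  suff -> : j' = k' by [].
  move: jP kP; rewrite !mem_reach => /andP[lej _] /andP[lek _].
  by apply/eqP; rewrite -eqz_nat -(dy_step_to _ _ lej) jk dy_step_to.
Qed.

Lemma b_completions n : b n = size (completions Up n 0).
Proof.
rewrite -(undup_id (uniq_completions Up n 0)) -card_fseq /b.
congr (#|` _|); apply/fsetP => p.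
rewrite in_fset_set; last exact: excursions_finite.
have sortedE q : sorted [rel s t : step | (s != Up) ==> (t == Up)] q =
    path [rel s t : step | (s != Up) ==> (t == Up)] Up q by case: q.
have heightE q : 0%:Z + height q = height q by rewrite add0r.
apply/idP/idP => [|pc].
  rewrite inE => -[[pos sp] sz hp]; rewrite in_fset; apply/completionsP.
  by split=> // [|i|]; rewrite -?sortedE ?heightE.
move: pc; rewrite in_fset => /completionsP[sz pp pos hp]; rewrite inE.
by split; [split; [move=> i; rewrite -heightE | rewrite sortedE] | | rewrite -heightE].
Qed.

(** * Solving the recurrence *)

Section Kernel.
Variables (K : fieldType) (rho : fps K).
Local Notation z := (fpsX K).
Hypothesis kernel_root : z * (1 + z) * rho ^+ 2 - (1 + z) * rho + 1 = 0.

(** The closed form of the generating function F_h of the completions from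
    height h that may begin with any step. *)
Definition free_gf (h : nat) : fps K :=
  (h == 0)%:R + ((1 + z) * rho - 1) * rho ^+ h.

Definition completion_gf (x : step) (h : nat) : fps K :=
  if x == Up then free_gf h else (h == 0)%:R + z * free_gf h.+1.

(** By induction on h: the case h = 0 is - (1 + z) times the equation of rho,
    and the difference between two successive instances is that equation
    multiplied by - ((1 + z) rho - 1) rho^h. *)
Lemma free_gf_rec h : free_gf h = (h == 0)%:R +
  z * (\sum_(0 <= j < h.+1) ((j == 0)%:R + z * free_gf j.+1) + free_gf h.+1).
Proof.
congr (_ + _); rewrite /free_gf /= !add0r.
elim: h => [|h IH].
  rewrite big_nat1 /= add0r expr0 expr1 mulr1.
  apply/eqP; rewrite -subr_eq0; apply/eqP.
  rewrite -(mulr0 (- (1 + z))) -kernel_root.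
  by ring.
rewrite big_nat_recr//= add0r.
move: IH; set S := \sum_(_ <= _ < _) _ => IH.
have {}IH : z * S =
    ((1 + z) * rho - 1) * rho ^+ h - z * (((1 + z) * rho - 1) * rho ^+ h.+1).
  by rewrite [in RHS]IH mulrDr addrK.
apply/eqP; rewrite -subr_eq0 !mulrDr IH; apply/eqP.
rewrite -(mulr0 (- ((1 + z) * rho - 1) * rho ^+ h)) -kernel_root !exprS.
by ring.
Qed.

Lemma completion_gf_rec x h : completion_gf x h = (h == 0)%:R +
  z * \sum_(j <- reach x h) completion_gf (step_to h j) j.
Proof.
rewrite {1}/completion_gf /reach; case: ifP => _; last first.
  by rewrite big_seq1 /completion_gf step_to_up eqxx.
rewrite free_gf_rec -[iota 0 h.+2]/(index_iota 0 h.+2) [in RHS]big_nat_recr//=.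
rewrite [completion_gf _ h.+1]/completion_gf step_to_up eqxx.
congr (_ + _ * (_ + _)); apply: eq_big_nat => j /andP[_ lt_j].
by rewrite /completion_gf step_to_up (ltn_eqF lt_j).
Qed.

(** A first step contributes a factor z, so the recurrence expresses the
    coefficients of z^(n+1) through those of z^n, just as the enumeration
    does. *)
Lemma size_completions x n h :
  (size (completions x n h))%:R = fcoef (completion_gf x h) n.
Proof.
elim: n x h => [|n IH] x h; rewrite completion_gf_rec fcoefD.
  by rewrite fcoef_Xmul0 addr0 fcoef_nat0 size_nseq.
rewrite fcoef_natS add0r fcoef_XmulS fcoef_sum size_allpairs_dep sumnE big_map.
by rewrite natr_sum; apply: eq_bigr => j _; rewrite IH.
Qed.

Lemma b_gf : Fps (fun n => (b n)%:R) = (1 + z) * rho.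
Proof.
apply/fpsP => n; rewrite /= b_completions size_completions.
by rewrite /completion_gf !eqxx /free_gf expr0 mulr1 addrC subrK.
Qed.

End Kernel.

(** * The two roots of the kernel *)

(** Rationalising the denominator: (z + 1)^2 - S^2 = 4 z (z + 1), so
    z + 1 + S is a root of w^2 - 2 (1 + z) w + 4 z (1 + z), and rho = 2 / w
    satisfies the reciprocal equation, up to a factor 4. *)
Lemma kernel_root_of_sqrt (K : fieldType) (S rho : fps K) : (2 : K) != 0 ->
  S ^+ 2 = 1 - 2 * fpsX K - 3 * fpsX K ^+ 2 -> rho * (fpsX K + 1 + S) = 2 ->
  fpsX K * (1 + fpsX K) * rho ^+ 2 - (1 + fpsX K) * rho + 1 = 0.
Proof.
move=> two_neq0 S2 rhoE.
set z := fpsX K in S2 rhoE *.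
have two_fps : (2 : fps K) != 0.
  by apply: contra two_neq0 => /eqP e; rewrite -fcoef_nat0 e.
have : 2 ^+ 2 * (z * (1 + z) * rho ^+ 2 - (1 + z) * rho + 1) = 0.
  have -> : 2 ^+ 2 * (z * (1 + z) * rho ^+ 2 - (1 + z) * rho + 1) =
    rho ^+ 2 * (S ^+ 2 - (1 - 2 * z - 3 * z ^+ 2))
    - (rho * (z + 1 + S) - 2) * (rho * (z + 1 + S) - 2 * (rho * (z + 1)) + 2).
    by ring.
  by rewrite -S2 rhoE !subrr mulr0 mul0r subr0.
by move/eqP; rewrite mulf_eq0 expf_eq0 (negPf two_fps) /= => /eqP.
Qed.

(** With c the small root and w / (2 x (x + 1)) the large one, this is the
    product of the roots. *)
Lemma inverse_kernel_root (F : fieldType) (x w c : F) :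
    x != 0 -> x + 1 != 0 -> w != 0 -> (2 : F) != 0 -> c * w = 2 ->
  (x + 1) * c = 1 / (x * (w / (2 * x * (x + 1)))).
Proof.
move=> x0 x10 w0 two0 cw; rewrite -[c](mulfK w0) cw.
by field; rewrite x0 x10 w0 two0.
Qed.

Theorem corollary5 :
  let z : laurent rat := fps_laurent (fpsX rat) in
  let sqrt_disc : laurent rat :=
    fps_laurent (fps_sqrt (1 - 2 * fpsX rat - 3 * fpsX rat ^+ 2)) in
  let r : laurent rat := (z + 1 + sqrt_disc) / (2 * z * (z + 1)) in
  fps_laurent (Fps (fun n => (b n)%:R : rat)) = 1 / (z * r).
Proof.
set D := (1 - 2 * fpsX rat - _); set S := fps_sqrt D => z sqrt_disc r.
have D0 : fcoef D 0 = 1.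
  have -> : D = 1 + fpsX rat * (- (2 + 3 * fpsX rat)) by rewrite /D; ring.
  by rewrite fcoefD fcoef_Xmul0 addr0.
have [S2 S0] := fps_sqrtP (isT : (2 : rat) != 0) D0.
rewrite -/S in S2 S0.
have w0 : fcoef (fpsX rat + 1 + S) 0 = 2 by rewrite !fcoefD S0.
have [v vw] : exists v, v * (fpsX rat + 1 + S) = 1.
  by apply: fps_inverse; rewrite w0.
have rhoE : 2 * v * (fpsX rat + 1 + S) = 2 by rewrite -mulrA vw mulr1.
have root := kernel_root_of_sqrt _ _ _ (isT : (2 : rat) != 0) S2 rhoE.
rewrite (b_gf _ _ root).
have nz (s : fps rat) n : fcoef s n != 0 -> fps_laurent s != 0.
  by move=> sn; rewrite tofrac_eq0; apply: contra sn => /eqP->.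
have z_neq0 : z != 0 by apply: (nz _ 1%N).
have z1E : z + 1 = fps_laurent (fpsX rat + 1) by rewrite /fps_laurent tofracD tofrac1.
have z1_neq0 : z + 1 != 0 by rewrite z1E; apply: (nz _ 0%N).
have wE : z + 1 + sqrt_disc = fps_laurent (fpsX rat + 1 + S).
  by rewrite /fps_laurent !tofracD tofrac1.
have w_neq0 : z + 1 + sqrt_disc != 0 by rewrite wE; apply: (nz _ 0%N); rewrite w0.
have twoE : (2 : laurent rat) = fps_laurent 2 by rewrite /fps_laurent tofracMn tofrac1.
have two_neq0 : (2 : laurent rat) != 0 by rewrite twoE; apply: (nz _ 0%N).
have -> : fps_laurent ((1 + fpsX rat) * (2 * v)) = (z + 1) * fps_laurent (2 * v).
  by rewrite z1E -tofracM [1 + _]addrC.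
have rhoL : fps_laurent (2 * v) * (z + 1 + sqrt_disc) = 2.
  by rewrite wE twoE /fps_laurent -tofracM rhoE.
rewrite /r; exact: (inverse_kernel_root _ z (z + 1 + sqrt_disc)).
Qed.
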